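(* Let $(\mathcal{J},\circ)$ be a Euclidean Jordan algebra with underlying vector space $\mathbb{R}^d$, with cone of squares $\mathcal{K}$ and canonical inner product $\langle x,y\rangle=\mathrm{tr}(x\circ y)$. Let $X\in\mathbb{R}^{m\times n}$ be an entrywise nonnegative matrix, and let $a_1,\dots,a_m,b_1,\dots,b_n\in\mathrm{int}(\mathcal{K})$. Define the linear maps $\mathcal{A}y=(\langle a_1,y\rangle,\dots,\langle a_m,y\rangle)^{T}$ and $\mathcal{B}y=(\langle b_1,y\rangle,\dots,\langle b_n,y\rangle)^{T}$ for $y\in\mathbb{R}^d$. Suppose that the $a_i$ and $b_j$ are fixed points of the multiplicative update rule, i.e. $$a_i=P\big(a_i\#(\mathcal{B}^{T}\mathcal{B}a_i)^{-1}\big)\mathcal{B}^{T}X_{i:}\ \text{ for all }1\le i\le m,\qquad b_j=P\big(b_j\#(\mathcal{A}^{T}\mathcal{A}b_j)^{-1}\big)\mathcal{A}^{T}X_{:j}\ \text{ for all }1\le j\le n.$$ Then $$\mathcal{B}^{T}X_{i:}=\mathcal{B}^{T}\mathcal{B}a_i\ \text{ for all } i\in\{1,\dots,m\},\qquad\text{and}\qquad \mathcal{A}^{T}X_{:j}=\mathcal{A}^{T}\mathcal{A}b_j\ \text{ for all } j\in\{1,\dots,n\}.$$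
   Context: A Jordan algebra is a finite-dimensional real vector space $\mathcal{J}$ with a bilinear product $\circ$ satisfying $x\circ y=y\circ x$ and $x^2\circ(x\circ y)=x\circ(x^2\circ y)$, where $x^2=x\circ x$; it is assumed to have an identity element $e$. It is Euclidean (an EJA) if it admits an inner product $(\cdot,\cdot)$ with $(x\circ y,z)=(y,x\circ z)$ for all $x,y,z$. An idempotent is an element $c$ with $c^2=c$; it is primitive if it is nonzero and is not a sum of two nonzero idempotents. A Jordan frame is a family $c_1,\dots,c_r$ of primitive idempotents with $c_i\circ c_j=0$ for $i\ne j$ and $\sum_i c_i=e$. Every $x\in\mathcal{J}$ can be written $x=\sum_{j=1}^r\lambda_jc_j$ for some Jordan frame and reals $\lambda_j$ (the eigenvalues of $x$, unique up to order, counted with multiplicity). One sets $\mathrm{tr}(x)=\sum_j\lambda_j$, and $x^{\alpha}=\sum_j\lambda_j^{\alpha}c_j$ whenever all $\lambda_j^\alpha$ are defined (in particular $x^{-1}$ and $x^{1/2}$). The canonical inner product is $\langle x,y\rangle=\mathrm{tr}(x\circ y)$. The cone of squares is $\mathcal{K}=\{x^2:x\in\mathcal{J}\}$; symmetric cones (self-dual homogeneous cones) are exactly the cones of squares of EJAs. With $L(x)y=x\circ y$, the quadratic representation of $x$ is the linear operator $P(x)=2L(x)^2-L(x^2)$. For $x,y\in\mathrm{int}(\mathcal{K})$ the geometric mean is $x\#y=P(x^{1/2})\big(P(x^{-1/2})y\big)^{1/2}\in\mathrm{int}(\mathcal{K})$. Adjoints $(\cdot)^{T}$ are taken with respect to $\langle\cdot,\cdot\rangle$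 on $\mathbb{R}^d=\mathcal{J}$ and the standard inner products on $\mathbb{R}^m,\mathbb{R}^n$; thus $\mathcal{A}^{T}y=\sum_iy_ia_i$ and $\mathcal{B}^{T}y=\sum_jy_jb_j$. $X_{i:}\in\mathbb{R}^n$ and $X_{:j}\in\mathbb{R}^m$ denote the $i$-th row and $j$-th column of $X$, viewed as vectors. The conclusion expresses first-order stationarity for minimizing $\sum_{i,j}(X_{ij}-\langle a_i,b_j\rangle)^2$ over $a_i,b_j\in\mathcal{K}$. *)

(* Defs.v *)
From HB Require Import structures.
From mathcomp Require Import all_boot all_order all_algebra.
From mathcomp Require Import all_classical all_reals all_analysis.

Set Implicit Arguments.
Unset Strict Implicit.
Unset Printing Implicit Defensive.

Import Order.TTheory GRing.Theory Num.Theory.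
Import numFieldNormedType.Exports.

Local Open Scope classical_set_scope.
Local Open Scope ring_scope.

Record jordanAlgebra (R : realType) (d : nat) := JordanAlgebra {
  jmul : {bilinear 'cV[R]_d -> 'cV[R]_d -> 'cV[R]_d};
  jone : 'cV[R]_d;
  jmulC : forall x y, jmul x y = jmul y x;
  jordan_identity : forall x y,
    jmul (jmul x x) (jmul x y) = jmul x (jmul (jmul x x) y);
  jmul1 : forall x, jmul jone x = x
}.

Section EuclideanJordanAlgebra.
Variables (R : realType) (d : nat) (J : jordanAlgebra R d).

Local Notation V := 'cV[R]_d.
Local Notation "x ∘ y" := (jmul J x y) (at level 40, left associativity).

(* The inner product is arbitrary, not necessarily the standard one on R^d. *)
Definition euclidean : Prop :=
  exists form : {dot V for idfun},
    forall x y z, form (x ∘ y) z = form y (x ∘ z).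

Definition idempotent (c : V) : Prop := c ∘ c = c.

Definition primitive_idempotent (c : V) : Prop :=
  [/\ idempotent c, c != 0 &
      ~ exists u v, [/\ idempotent u, idempotent v, u != 0, v != 0 &
                        c = u + v]].

Definition jordan_frame (r : nat) (c : 'I_r -> V) : Prop :=
  [/\ forall i, primitive_idempotent (c i),
      forall i j, i != j -> c i ∘ c j = 0 &
      \sum_i c i = jone J].

Definition spectral_decomposition (x : V) (r : nat) (lambda : 'I_r -> R)
    (c : 'I_r -> V) : Prop :=
  jordan_frame c /\ x = \sum_j lambda j *: c j.

(* The trace and the spectral functions below are read off from an arbitrary
   spectral decomposition of x: in a Euclidean Jordan algebra one exists and
   the values do not depend on it, so xget selects from a singleton. *)
Definition jtrace (x : V) : R :=
  xget 0 [set t | exists r (lambda : 'I_r -> R) (c : 'I_r -> V),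
    spectral_decomposition x lambda c /\ t = \sum_j lambda j].

Definition spectral_map (f : R -> R) (x : V) : V :=
  xget 0 [set y | exists r (lambda : 'I_r -> R) (c : 'I_r -> V),
    spectral_decomposition x lambda c /\ y = \sum_j f (lambda j) *: c j].

(* x^-1, x^(1/2) and x^(-1/2); the values are meaningful only when all the
   eigenvalues are nonzero, nonnegative and positive, respectively. *)
Definition jinv (x : V) : V := spectral_map (fun t => t^-1) x.
Definition jsqrt (x : V) : V := spectral_map (fun t => Num.sqrt t) x.
Definition jinvsqrt (x : V) : V := spectral_map (fun t => (Num.sqrt t)^-1) x.

Definition jinner (x y : V) : R := jtrace (x ∘ y).

Definition cone_of_squares : set V := [set x ∘ x | x in [set: V]].

Definition jL (x y : V) : V := x ∘ y.

Definition jP (x y : V) : V := 2 *: jL x (jL x y) - jL (x ∘ x) y.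

Definition gmean (x y : V) : V :=
  jP (jsqrt x) (jsqrt (jP (jinvsqrt x) y)).

(* For a family a in V, the map y |-> (<a_1, y>, ..., <a_k, y>) and its adjoint
   with respect to <., .> on V and the standard inner product on R^k. *)
Definition inner_map (k : nat) (a : 'I_k -> V) (y : V) : 'cV[R]_k :=
  \col_i jinner (a i) y.

Definition inner_map_adj (k : nat) (a : 'I_k -> V) (y : 'cV[R]_k) : V :=
  \sum_i y i 0 *: a i.

End EuclideanJordanAlgebra.

(* Main.v *)
(* For u = B^T B a in int K, the geometric mean w = a # u^-1 is a solution of the
   Riccati equation P(w) u = a, and P(w) is injective. The fixed-point equation
   P(w) (B^T X) = a therefore forces B^T X = u.

   The Riccati equation follows from the fundamental formula
   P(P(x) y) = P(x) P(y) P(x), which is deduced from the five-linear identity of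
   the Jordan triple product. That u is in int K follows from <b_j, a> > 0, which
   rests on the linearity of the trace: if f is any associative inner product
   and (c_i) a Jordan frame, then x |-> sum_i f(c_i, x) / f(c_i, c_i) is linear
   and equal to 1 at every primitive idempotent, because two primitive
   idempotents that are not f-orthogonal have the same f-norm. *)

Require Import Defs.
From HB Require Import structures.
From mathcomp Require Import all_boot all_order all_algebra.
From mathcomp Require Import all_classical all_reals all_analysis.
From mathcomp Require Import complex ring lra zify.

Set Implicit Arguments.
Unset Strict Implicit.
Unset Printing Implicit Defensive.

Import Order.TTheory GRing.Theory Num.Theory.
Import numFieldNormedType.Exports.

Local Open Scope classical_set_scope.
Local Open Scope ring_scope.

(** * The fundamental formula *)

Section JordanIdentities.
Variables (R : realType) (d : nat) (J : jordanAlgebra R d).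

Local Notation V := 'cV[R]_d.
Local Notation "x ∘ y" := (jmul J x y) (at level 40, left associativity).
Implicit Types x y z u v w : V.

Lemma jmulDl x y z : (x + y) ∘ z = x ∘ z + y ∘ z. Proof. exact: linearDl. Qed.
Lemma jmulDr x y z : x ∘ (y + z) = x ∘ y + x ∘ z. Proof. exact: linearDr. Qed.
Lemma jmulNl x y : (- x) ∘ y = - (x ∘ y). Proof. exact: linearNl. Qed.
Lemma jmulNr x y : x ∘ (- y) = - (x ∘ y). Proof. exact: linearNr. Qed.
Lemma jmulZl k x y : (k *: x) ∘ y = k *: (x ∘ y).
Proof. by rewrite linearZl_LR. Qed.
Lemma jmulZr k x y : x ∘ (k *: y) = k *: (x ∘ y).
Proof. by rewrite linearZr_LR. Qed.
Lemma jmul0l x : 0 ∘ x = 0. Proof. exact: linear0l. Qed.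
Lemma jmul0r x : x ∘ 0 = 0. Proof. exact: linear0r. Qed.
Lemma jmul_suml (I : Type) (r : seq I) (P : pred I) (F : I -> V) x :
  (\sum_(i <- r | P i) F i) ∘ x = \sum_(i <- r | P i) F i ∘ x.
Proof. exact: linear_sumlz. Qed.
Lemma jmul_sumr (I : Type) (r : seq I) (P : pred I) (F : I -> V) x :
  x ∘ (\sum_(i <- r | P i) F i) = \sum_(i <- r | P i) x ∘ F i.
Proof. exact: linear_sumr. Qed.
Lemma jmulr1 x : x ∘ jone J = x. Proof. by rewrite jmulC jmul1. Qed.

(* Orients all products so that no two atoms differ only by commutativity. *)
Ltac jmul_sort := repeat match goal with
  | |- context [Bilinear.sort (jmul J) ?a ?b] =>
    match goal with
    | |- context [Bilinear.sort (jmul J) b a] =>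
      tryif constr_eq a b then fail else rewrite (jmulC J b a)
    end
  end.

Definition jmulE := (jmulDl, jmulDr, jmulNl, jmulNr, jmulZl, jmulZr).

(** The Jordan identity is cubic in x; its instances at x + z, x - z and z isolate the part linear
    in z. *)
Lemma jordan_linearized1 x z w :
  (x ∘ x) ∘ (z ∘ w) + 2 *: ((x ∘ z) ∘ (x ∘ w))
  = z ∘ ((x ∘ x) ∘ w) + 2 *: (x ∘ ((x ∘ z) ∘ w)).
Proof.
apply/colP => i.
have := congr1 (fun t : V => t i 0) (jordan_identity J (x + z) w).
have := congr1 (fun t : V => t i 0) (jordan_identity J (x - z) w).
have := congr1 (fun t : V => t i 0) (jordan_identity J z w).
by rewrite !jmulE !mxE; jmul_sort; lra.
Qed.

Lemma jordan_linearized x y z w :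
  (x ∘ y) ∘ (z ∘ w) + (y ∘ z) ∘ (x ∘ w) + (z ∘ x) ∘ (y ∘ w)
  = z ∘ ((x ∘ y) ∘ w) + x ∘ ((y ∘ z) ∘ w) + y ∘ ((z ∘ x) ∘ w).
Proof.
apply/colP => i.
have := congr1 (fun t : V => t i 0) (jordan_linearized1 (x + y) z w).
have := congr1 (fun t : V => t i 0) (jordan_linearized1 x z w).
have := congr1 (fun t : V => t i 0) (jordan_linearized1 y z w).
by rewrite !jmulE !mxE; jmul_sort; lra.
Qed.

(** The two instances of [jordan_linearized] with x and y exchanged have the same left-hand side;
    compare the right-hand sides. *)
Lemma jmul_derivation x y u v :
  x ∘ (y ∘ (u ∘ v)) - y ∘ (x ∘ (u ∘ v))
  = (x ∘ (y ∘ u) - y ∘ (x ∘ u)) ∘ v + u ∘ (x ∘ (y ∘ v) - y ∘ (x ∘ v)).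
Proof.
apply/colP => i.
have := congr1 (fun t : V => t i 0) (jordan_linearized u y v x).
have := congr1 (fun t : V => t i 0) (jordan_linearized u x v y).
by rewrite !jmulE !mxE; jmul_sort; lra.
Qed.

(** The Jordan triple product, normalized so that P(x) y is its value at (x, y, x). *)
Definition jtriple x y z := x ∘ (y ∘ z) + z ∘ (y ∘ x) - (x ∘ z) ∘ y.
Local Notation T := jtriple.

Lemma jtripleC x y z : T x y z = T z y x.
Proof. by rewrite /T (jmulC J z x) (addrC (x ∘ _)). Qed.

Lemma jPE x y : jP J x y = T x y x.
Proof. by rewrite /jP /jL /T scaler_nat (jmulC J y x). Qed.

(** This is [jtriple_five] at x = a, y = e, because T a e and T e a both equal L(a). *)
Lemma jmul_jtriple a u v z :
  a ∘ T u v z = T (a ∘ u) v z - T u (a ∘ v) z + T u v (a ∘ z).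
Proof.
apply/colP => i.
have := congr1 (fun t : V => t i 0) (jordan_linearized u v z a).
have := congr1 (fun t : V => t i 0) (jordan_linearized a u v z).
have := congr1 (fun t : V => t i 0) (jordan_linearized a u z v).
have := congr1 (fun t : V => t i 0) (jordan_linearized a v z u).
by rewrite /T !jmulE !mxE; jmul_sort; lra.
Qed.

Lemma jtripleDl x x' y z : T (x + x') y z = T x y z + T x' y z.
Proof. by apply/colP => i; rewrite /T !jmulE !mxE; lra. Qed.
Lemma jtripleDm x y y' z : T x (y + y') z = T x y z + T x y' z.
Proof. by apply/colP => i; rewrite /T !jmulE !mxE; lra. Qed.
Lemma jtripleDr x y z z' : T x y (z + z') = T x y z + T x y z'.
Proof. by rewrite ![T x y _]jtripleC jtripleDl. Qed.
Lemma jtripleNm x y z : T x (- y) z = - T x y z.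
Proof. by apply/colP => i; rewrite /T !jmulE !mxE; lra. Qed.
Lemma jtripleZm k x y z : T x (k *: y) z = k *: T x y z.
Proof. by apply/colP => i; rewrite /T !jmulE !mxE; ring. Qed.

Let D x y z := x ∘ (y ∘ z) - y ∘ (x ∘ z).

Lemma jtriple_derivation x y u v z :
  D x y (T u v z) = T (D x y u) v z + T u (D x y v) z + T u v (D x y z).
Proof.
have DD s t : D x y (s + t) = D x y s + D x y t.
  by apply/colP => i; rewrite /D !jmulE !mxE; lra.
have DN s : D x y (- s) = - D x y s.
  by apply/colP => i; rewrite /D !jmulE !mxE; lra.
have DM s t : D x y (s ∘ t) = D x y s ∘ t + s ∘ D x y t.
  exact: jmul_derivation.
by rewrite {1 2 3 4}/T !(DD, DN, DM) !jmulE; apply/colP => i; rewrite !mxE; lra.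
Qed.

Lemma jtripleDE x y z : T x y z = (x ∘ y) ∘ z + D x y z.
Proof.
rewrite /T /D (jmulC J z) (jmulC J y x) (jmulC J (x ∘ z) y).
by apply/colP => i; rewrite !mxE; lra.
Qed.

(* The operator z |-> T x y z is L(x y) + [L x, L y]; L(a) and the derivation
   [L x, L y] act on T by jmul_jtriple and jtriple_derivation, and exchanging
   x and y changes the sign of the derivation only. *)
Lemma jtriple_five x y u v z :
  T x y (T u v z) = T (T x y u) v z - T u (T y x v) z + T u v (T x y z).
Proof.
have DC s : D y x s = - D x y s by rewrite /D opprB.
rewrite [LHS]jtripleDE jtriple_derivation jmul_jtriple (jtripleDE x y u).
rewrite (jtripleDE y x v) (jtripleDE x y z) DC (jmulC J y x).
rewrite !(jtripleDl, jtripleDm, jtripleDr, jtripleNm).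
by apply/colP => i; rewrite !mxE; lra.
Qed.

Local Notation P := (jP J).

(** Expand T x y (T x v z) and T x v (T x y z) by [jtriple_five] and add: the last term of each
    expansion is the left-hand side of the other. *)
Lemma jtriple_jP_swap x y v z :
  T (P x y) v z + T (P x v) y z = 2 *: T x (T y x v) z.
Proof.
have h1 := jtriple_five x y x v z.
have h2 := jtriple_five x v x y z.
rewrite (jtripleC v x y) in h2.
apply/colP => i; rewrite !jPE.
have := congr1 (fun t : V => t i 0) h1; have := congr1 (fun t : V => t i 0) h2.
rewrite !mxE; lra.
Qed.

Lemma jtriple_jP_shift x y z : T (P x y) y z = T x (P y x) z.
Proof.
have h := jtriple_jP_swap x y y z.
apply/colP => i; rewrite (jPE y).
have := congr1 (fun t : V => t i 0) h.
rewrite !mxE; lra.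
Qed.

(** Let A be the left side, B the same with y and v exchanged, C the right side, which is symmetric
    in y and v. Then A = 2B - C and B = 2A - C, so A = C. *)
Lemma jtriple_jP_in x y v : T x y (P x v) = P x (T y x v).
Proof.
have h1 := jtriple_five x y x v x.
have h2 := jtriple_five x v x y x.
rewrite (jtripleC v x y) -!jPE in h2; rewrite -!jPE in h1.
rewrite (jtripleC (P x y)) in h1; rewrite (jtripleC (P x v)) in h2.
apply/colP => i.
have := congr1 (fun t : V => t i 0) h1; have := congr1 (fun t : V => t i 0) h2.
rewrite !mxE; lra.
Qed.

Lemma jP_sub x y z : P x (y - z) = P x y - P x z.
Proof. by rewrite !jPE jtripleDm jtripleNm. Qed.

Lemma jPZ x k y : P x (k *: y) = k *: P x y.
Proof. by rewrite !jPE jtripleZm. Qed.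

Lemma jP0 x : P x 0 = 0.
Proof. by have := jPZ x 0 0; rewrite !scale0r. Qed.

(** [h1] expresses P(P x y) z by two triple products with last argument P x y. Both are images under
    P x ([h2], [h3]), and [h4] recognizes the combined preimage as P y (P x z). *)
Lemma jP_fundamental x y z : P (P x y) z = P x (P y (P x z)).
Proof.
have h1 := jtriple_jP_swap x y z (P x y).
have h2 : T (P x z) y (P x y) = P x (T (P y x) x z).
  by rewrite jtripleC jtriple_jP_shift jtriple_jP_in.
have h3 : T x (T y x z) (P x y) = P x (T (T y x z) x y) by rewrite jtriple_jP_in.
have h4 : P y (P x z) = 2 *: T (T y x z) x y - T (P y x) x z.
  have h := jtriple_five z x y x y.
  rewrite -!jPE (jtripleC z x (P y x)) (jtripleC z x y) in h.
  rewrite (jtripleC y x (T y x z)) in h.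
  apply/colP => i; have := congr1 (fun t : V => t i 0) h; rewrite !mxE; lra.
rewrite h4 jP_sub jPZ -h2 -h3 (jPE (P x y)).
by apply/colP => i; have := congr1 (fun t : V => t i 0) h1; rewrite !mxE; lra.
Qed.

Lemma jP1 x : P x (jone J) = x ∘ x.
Proof.
rewrite /jP /jL !jmulr1 scaler_nat.
by apply/colP => i; rewrite !mxE; lra.
Qed.

Lemma jP_one x : P (jone J) x = x.
Proof.
by rewrite /jP /jL !jmul1 scaler_nat mulr2n addrK.
Qed.

Lemma jP_sqr x y : P x y ∘ P x y = P x (P y (x ∘ x)).
Proof. by rewrite -jP1 jP_fundamental jP1. Qed.

End JordanIdentities.

(** * Power associativity *)

Section Powers.
Variables (R : realType) (d : nat) (J : jordanAlgebra R d).

Local Notation V := 'cV[R]_d.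
Local Notation "x ∘ y" := (jmul J x y) (at level 40, left associativity).
Local Notation e := (jone J).
Local Notation P := (jP J).
Implicit Types (x y z v : V) (p q : {poly R}).

(** For z a power of x this is the recursion giving L(x^(n+2)) from lower powers; for x = z
    idempotent it gives the Peirce cubic. *)
Lemma jmul_sqr_mul x z v :
  ((x ∘ x) ∘ z) ∘ v
  = (x ∘ x) ∘ (z ∘ v) + 2 *: ((x ∘ z) ∘ (x ∘ v)) - 2 *: (x ∘ (z ∘ (x ∘ v))).
Proof.
have := jordan_linearized J x x v z; rewrite (jmulC J v x) (jmulC J v z).
rewrite (jmulC J v) (jmulC J (x ∘ v) (x ∘ z)) (jmulC J (x ∘ v) z) => h.
apply/colP => i; have := congr1 (fun t : V => t i 0) h; rewrite !mxE; lra.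
Qed.

Definition jpow x n := iter n (jmul J x) e.

Lemma jpowS x n : jpow x n.+1 = x ∘ jpow x n. Proof. by []. Qed.

Lemma jmul_sqr_pow x n : (x ∘ x) ∘ jpow x n = jpow x n.+2.
Proof.
by elim: n => [|n IHn]; rewrite ?jpowS /= ?jmulr1 // jordan_identity IHn.
Qed.

(** The recursion for L(x^(n+2)) involves both x^n and x^(n+1), so the induction carries two
    consecutive powers. *)
Lemma jpow_comm x n v : x ∘ (jpow x n ∘ v) = jpow x n ∘ (x ∘ v).
Proof.
suff: (forall v, x ∘ (jpow x n ∘ v) = jpow x n ∘ (x ∘ v)) /\
      (forall v, x ∘ (jpow x n.+1 ∘ v) = jpow x n.+1 ∘ (x ∘ v)) by case.
elim: n => [|n [IH1 IH2]]; first by split=> w; rewrite /= ?jmulr1 ?jmul1.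
split=> // w; rewrite -jmul_sqr_pow !jmul_sqr_mul -!jpowS.
rewrite !(jmulDr, jmulNr, jmulZr) -!jordan_identity IH1.
rewrite ![x ∘ (_ ∘ (x ∘ w))]IH2.
by rewrite IH1.
Qed.

Definition jeval x p := \sum_(k < size p) p`_k *: jpow x k.

Lemma jevalE n x p : (size p <= n)%N -> jeval x p = \sum_(k < n) p`_k *: jpow x k.
Proof.
move=> le_pn; rewrite /jeval (big_ord_widen n (fun k => p`_k *: jpow x k)) //.
rewrite big_mkcond; apply: eq_bigr => k _; case: ltnP => // le_pk.
by rewrite nth_default // scale0r.
Qed.

Lemma jevalD x p q : jeval x (p + q) = jeval x p + jeval x q.
Proof.
set n := maxn (size p) (size q).
rewrite !(@jevalE n) ?leq_maxl ?leq_maxr ?size_polyD // -big_split.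
by apply: eq_bigr => k _; rewrite coefD scalerDl.
Qed.

Lemma jevalC x c : jeval x c%:P = c *: e.
Proof. by rewrite (@jevalE 1) ?size_polyC_leq1 // big_ord1 coefC. Qed.

Lemma jeval0 x : jeval x 0 = 0. Proof. by rewrite /jeval size_poly0 big_ord0. Qed.

Lemma jevalMX x p : jeval x (p * 'X) = x ∘ jeval x p.
Proof.
rewrite (@jevalE (size p).+1) ?size_mulX_leq //; last first.
  by rewrite (leq_trans (size_polyMleq _ _)) // size_polyX addn2.
rewrite big_ord_recl coefMX /= scale0r add0r jmul_sumr.
by apply: eq_bigr => k _; rewrite coefMX /= jmulZr.
Qed.

Lemma jeval_comm x p v : x ∘ (jeval x p ∘ v) = jeval x p ∘ (x ∘ v).
Proof.
rewrite !jmul_suml jmul_sumr; apply: eq_bigr => k _.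
by rewrite !(jmulZl, jmulZr) jpow_comm.
Qed.

(** Power associativity: in the induction on p, [jeval_comm] moves the factor x past q(x). *)
Lemma jevalM x p q : jeval x (p * q) = jeval x p ∘ jeval x q.
Proof.
elim/poly_ind: p => [|p c IHp]; first by rewrite mul0r jeval0 jmul0l.
rewrite mulrDl mulrAC jevalD jevalMX IHp jevalD jevalMX jevalC jmulDl jmulZl jmul1.
rewrite (jmulC J (jeval x p)) jeval_comm jmulC; congr (_ + _).
elim/poly_ind: q {IHp} => [|q b IHq]; first by rewrite mulr0 jeval0 scaler0.
rewrite mulrDr mulrA !jevalD !jevalMX -polyCM !jevalC IHq.
by rewrite scalerDr jmulZr scalerA.
Qed.

Lemma jeval1 x : jeval x 1 = e. Proof. by rewrite jevalC scale1r. Qed.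
Lemma jevalX x : jeval x 'X = x.
Proof. by rewrite -['X]mul1r jevalMX jeval1 jmulr1. Qed.
Lemma jevalZ x k p : jeval x (k *: p) = k *: jeval x p.
Proof. by rewrite -mul_polyC jevalM jevalC jmulZl jmul1. Qed.
Lemma jevalB x p q : jeval x (p - q) = jeval x p - jeval x q.
Proof. by rewrite jevalD -(scaleN1r q) jevalZ scaleN1r. Qed.
Lemma jeval_sum x (I : Type) (r : seq I) (F : I -> {poly R}) :
  jeval x (\sum_(i <- r) F i) = \sum_(i <- r) jeval x (F i).
Proof. exact: (big_morph _ (jevalD x) (jeval0 x)). Qed.

Lemma jeval_annihilator x : exists2 p, p != 0 & jeval x p = 0.
Proof.
pose A := \matrix_(k < d.+1, i < d) jpow x k i 0.
have : ~~ row_free A by rewrite /row_free neq_ltn ltnS rank_leq_col.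
rewrite -kermx_eq0 => /rowV0Pn [u /sub_kermxP uA u_neq0].
exists (\poly_(k < d.+1) u 0 (inord k)).
  apply: contra u_neq0 => /eqP p0; apply/eqP/rowP => k; rewrite mxE.
  have := congr1 (fun p : {poly R} => p`_k) p0.
  by rewrite coef_poly coef0 ltn_ord inord_val.
rewrite (@jevalE d.+1) ?size_poly //; apply/colP => i.
have := congr1 (fun w : 'rV[R]_d => w 0 i) uA; rewrite summxE !mxE => uAi.
rewrite -[RHS]uAi; apply: eq_bigr => k _.
by rewrite !mxE coef_poly ltn_ord inord_val.
Qed.

(** L(c) is annihilated by t(2t - 1)(t - 1), whose roots are the Peirce eigenvalues 0, 1/2, 1. *)
Lemma jidem_cubic c v : c ∘ c = c ->
  c ∘ v = 3 *: (c ∘ (c ∘ v)) - 2 *: (c ∘ (c ∘ (c ∘ v))).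
Proof.
move=> cc; have := jmul_sqr_mul c c v; rewrite !cc => h.
apply/colP => i; have := congr1 (fun t : V => t i 0) h; rewrite !mxE; lra.
Qed.

(** P(c) is t(2t - 1) at t = L(c), so the Peirce cubic puts its image in the eigenspace of 1. *)
Lemma jP_jidemK c v : c ∘ c = c -> c ∘ P c v = P c v.
Proof.
move=> cc; rewrite /jP /jL cc !(jmulDr, jmulNr, jmulZr).
have h := jidem_cubic v cc.
apply/colP => i; have := congr1 (fun t : V => t i 0) h; rewrite !mxE; lra.
Qed.

Lemma jP_jidem_id c v : c ∘ c = c -> c ∘ v = v -> P c v = v.
Proof.
by move=> cc cv; rewrite /jP /jL cc !cv scaler_nat mulr2n addrK.
Qed.

(** For squares, u = P(c) u makes u^2 = P(c) P(u) c^2 an element of the image of P(c); then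
    polarize. *)
Lemma jidem_subalgebra c v w : c ∘ c = c -> c ∘ v = v -> c ∘ w = w ->
  c ∘ (v ∘ w) = v ∘ w.
Proof.
move=> cc; have sq u : c ∘ u = u -> c ∘ (u ∘ u) = u ∘ u.
  by move=> cu; rewrite -(jP_jidem_id cc cu) jP_sqr jP_jidemK.
move=> cv cw; have := sq (v + w); rewrite jmulDr cv cw => /(_ erefl).
rewrite !(jmulDl, jmulDr) (jmulC J w v) sq // sq // => h.
apply/colP => i; have := congr1 (fun t : V => t i 0) h; rewrite !mxE; lra.
Qed.

End Powers.

(** * Real polynomials *)

Section RealPolynomials.
Variable R : realType.
Implicit Types (p q : {poly R}) (rs : seq R).

(** Take a complex root a + ib. If b is nonzero, the remainder modulo the quadratic has degree at
    most one and a nonreal root, so it vanishes. *)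
Lemma real_poly_factor p : (1 < size p)%N ->
  (exists a, root p a) \/
  exists a b q, b != 0 /\ p = (('X - a%:P) ^+ 2 + (b ^+ 2)%:P) * q.
Proof.
move=> p_gt1; pose toC := real_complex R.
have /closed_rootP[[a b] pz] : size (map_poly toC p) != 1%N.
  by rewrite size_map_poly neq_ltn p_gt1 orbT.
have [b0|b_neq0] := eqVneq b 0.
  left; exists a; rewrite b0 in pz.
  by rewrite -(fmorph_root toC).
right; set q2 := ('X - a%:P) ^+ 2 + (b ^+ 2)%:P.
exists a, b, (p %/ q2); split=> //.
have sz_q2 : size q2 = 3%N.
  rewrite /q2 size_polyDl ?size_exp_XsubC //.
  by rewrite (leq_ltn_trans (size_polyC_leq1 _)).
have q2_neq0 : q2 != 0 by rewrite -size_poly_gt0 sz_q2.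
have q2z : (map_poly toC q2).[a +i* b]%C = 0.
  rewrite /q2 rmorphD rmorphXn /= map_polyXsubC map_polyC /= !hornerE /toC.
  apply/eqP; rewrite eq_complex /=; apply/andP; split; apply/eqP; ring.
suff r0 : p %% q2 = 0 by rewrite [LHS](divp_eq p q2) r0 addr0 mulrC.
have : (map_poly toC (p %% q2)).[a +i* b]%C = 0.
  move/rootP: pz; rewrite {1}(divp_eq p q2) rmorphD rmorphM hornerD hornerM.
  by rewrite q2z mulr0 add0r.
have sz_r : (size (p %% q2)%R <= 2)%N by rewrite -ltnS -sz_q2 ltn_modp.
rewrite (@horner_coef_wide _ 2) ?size_map_poly // !big_ord_recl big_ord0 /=.
rewrite !coef_map /= expr0 expr1 addr0 mulr1 /bump /= addn0 => /eqP.
rewrite eq_complex /= => /andP[/eqP hre /eqP him].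
have r1 : (p %% q2)`_1 = 0.
  by apply/eqP; rewrite -(mulIr_eq0 _ (mulIf b_neq0)); apply/eqP; lra.
have r0 : (p %% q2)`_0 = 0 by rewrite r1 in hre; lra.
apply/polyP => -[|[|k]]; rewrite coef0 //.
by rewrite nth_default // (leq_trans sz_r).
Qed.

Definition lagrange_poly rs r : {poly R} :=
  \prod_(s <- rs | s != r) ((r - s)^-1 *: ('X - s%:P)).

Lemma lagrange_polyE rs r s : r \in rs -> s \in rs ->
  (lagrange_poly rs r).[s] = (s == r)%:R.
Proof.
move=> r_in s_in; rewrite horner_prod; have [->|neq] := eqVneq s r.
  rewrite big1_seq // => t /andP[neq _].
  by rewrite !hornerE mulVf // subr_eq0 eq_sym.
by rewrite big_mkcond (big_rem s) //= neq !hornerE subrr mulr0 mul0r.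
Qed.

Lemma interpolation rs (f : R -> R) : uniq rs ->
  exists p, forall t, t \in rs -> p.[t] = f t.
Proof.
move=> rs_uniq; exists (\sum_(r <- rs) f r *: lagrange_poly rs r) => t t_in.
rewrite horner_sum (bigD1_seq t) //= hornerZ lagrange_polyE // eqxx mulr1.
rewrite big1_seq ?addr0 // => r /andP[neq r_in].
by rewrite hornerZ lagrange_polyE // eq_sym (negPf neq) mulr0.
Qed.

End RealPolynomials.

(** * Spectral decomposition, trace and positivity *)

Section SpectralTheorem.
Variables (R : realType) (d : nat) (J : jordanAlgebra R d).

Local Notation V := 'cV[R]_d.
Local Notation "x ∘ y" := (jmul J x y) (at level 40, left associativity).
Local Notation e := (jone J).
Local Notation P := (jP J).
Implicit Types (x y z v : V) (p q : {poly R}).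

Variables (f : {dot V for idfun}).
Hypothesis fA : forall x y z, f (x ∘ y) z = f y (x ∘ z).

(** * Associative inner products and sums of squares *)

Lemma dotC x y : f x y = f y x.
Proof. by rewrite (hermitian_subproof x y) expr0 mul1r. Qed.
Lemma dotDl x y z : f (x + y) z = f x z + f y z. Proof. exact: linearDl. Qed.
Lemma dotNl x y : f (- x) y = - f x y. Proof. exact: linearNl. Qed.
Lemma dot0l x : f 0 x = 0. Proof. exact: linear0l. Qed.
Lemma dotZl k x y : f (k *: x) y = k * f x y.
Proof. by rewrite linearZl_LR. Qed.
Lemma dot_suml (I : Type) (r : seq I) (Q : pred I) (F : I -> V) x :
  f (\sum_(i <- r | Q i) F i) x = \sum_(i <- r | Q i) f (F i) x.
Proof. exact: linear_sumlz. Qed.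
Lemma dotDr x y z : f z (x + y) = f z x + f z y.
Proof. by rewrite -!(dotC _ z) dotDl. Qed.
Lemma dotNr x y : f y (- x) = - f y x.
Proof. by rewrite -!(dotC _ y) dotNl. Qed.
Lemma dotZr k x y : f y (k *: x) = k * f y x.
Proof. by rewrite -!(dotC _ y) dotZl. Qed.
Lemma dot_sumr (I : Type) (r : seq I) (Q : pred I) (F : I -> V) x :
  f x (\sum_(i <- r | Q i) F i) = \sum_(i <- r | Q i) f x (F i).
Proof. by rewrite dotC dot_suml; apply: eq_bigr => i _; rewrite dotC. Qed.

Lemma dot_gt0 x : x != 0 -> 0 < f x x. Proof. exact: neq0_dnorm_gt0. Qed.
Lemma dot_ge0 x : 0 <= f x x.
Proof.
by have [->|/dot_gt0/ltW//] := eqVneq x 0; rewrite dot0l.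
Qed.
Lemma dot_eq0 x : f x x = 0 -> x = 0.
Proof. by have [->//|/dot_gt0 + fx0] := eqVneq x 0; rewrite fx0 ltxx. Qed.

Lemma dot_sqr x : f (x ∘ x) e = f x x. Proof. by rewrite fA jmulr1. Qed.

Lemma sqr_sum_eq0 x y : x ∘ x + y ∘ y = 0 -> x = 0 /\ y = 0.
Proof.
move/(congr1 (fun t => f t e)); rewrite dotDl !dot_sqr dot0l => h.
have := dot_ge0 x; have := dot_ge0 y.
by split; apply: dot_eq0; lra.
Qed.

(* A linear factor occurring twice, or a quadratic one without real roots, can
   be simplified: multiplying the annihilator by its cofactor gives a vanishing
   sum of squares. *)
Lemma jeval_split x :
  exists2 rs, uniq rs & jeval J x (\prod_(r <- rs) ('X - r%:P)) = 0.
Proof.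
have [h h_neq0 hx] := jeval_annihilator J x.
(* [rs] holds the distinct roots extracted so far and [g] is the remaining cofactor, whose size
   drops at each step. *)
suff claim n (g : {poly R}) rs : (size g <= n)%N -> g != 0 -> uniq rs ->
    jeval J x (\prod_(r <- rs) ('X - r%:P) * g) = 0 ->
    exists2 rs, uniq rs & jeval J x (\prod_(r <- rs) ('X - r%:P)) = 0.
  by apply: (claim _ h [::] (leqnn _)) => //; rewrite big_nil mul1r.
elim: n g rs => [|n IHn] g rs.
  by rewrite leqn0 size_poly_eq0 => /eqP->; rewrite eqxx.
move=> sz_g g_neq0 rs_uniq; set Q := \prod_(r <- rs) _ => Qg.
have [g_le1|g_gt1] := leqP (size g) 1.
  have /size_poly1P[c c_neq0 gE] : size g == 1%N.
    by rewrite eqn_leq g_le1 size_poly_gt0.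
  exists rs => //; move: Qg; rewrite gE mulrC mul_polyC jevalZ => /eqP.
  by rewrite scaler_eq0 (negPf c_neq0) => /eqP.
have [[a /factor_theorem[q gE]]|[a [b [q [b_neq0 gE]]]]] := real_poly_factor g_gt1.
  have q_neq0 : q != 0 by apply: contra g_neq0 => /eqP q0; rewrite gE q0 mul0r.
  have sz_q : (size q <= n)%N.
    by rewrite -ltnS; move: sz_g; rewrite gE size_Mmonic ?monicXsubC // size_XsubC addn2.
  have [a_in|a_notin] := boolP (a \in rs).
    apply: (IHn q rs) => //; rewrite -/Q.
    have QE : Q = ('X - a%:P) * \prod_(r <- rem a rs) ('X - r%:P).
      by rewrite /Q (big_rem a).
    set S := \prod_(r <- rem a rs) _ in QE.
    have [|Qq _ //] := @sqr_sum_eq0 (jeval J x (Q * q)) 0.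
    rewrite jmul0l addr0 -jevalM.
    rewrite (_ : Q * q * (Q * q) = Q * g * (S * q)); last by rewrite gE QE; ring.
    by rewrite jevalM Qg jmul0l.
  apply: (IHn q (a :: rs)) => //=; first by rewrite a_notin.
  by rewrite big_cons -/Q -Qg gE; congr jeval; ring.
have q_neq0 : q != 0 by apply: contra g_neq0 => /eqP q0; rewrite gE q0 mulr0.
apply: (IHn q rs) => //; rewrite -/Q.
  have sz_ab : size (('X - a%:P) ^+ 2 + (b ^+ 2)%:P) = 3%N.
    rewrite size_polyDl ?size_exp_XsubC //.
    by rewrite (leq_ltn_trans (size_polyC_leq1 _)).
  move: sz_g; rewrite gE size_mul ?sz_ab //; last by rewrite -size_poly_gt0 sz_ab.
  by rewrite addSn /= => /ltnW.
have [|_] := @sqr_sum_eq0 (jeval J x (('X - a%:P) * (Q * q))) (jeval J x (b%:P * (Q * q))).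
  rewrite -!jevalM -jevalD.
  rewrite (_ : _ + _ = Q * g * (Q * q) :> {poly R}).
    by rewrite jevalM Qg jmul0l.
  by rewrite gE rmorphXn /=; ring.
by rewrite mul_polyC jevalZ => /eqP; rewrite scaler_eq0 (negPf b_neq0) => /eqP.
Qed.

Lemma jeval_vanish x rs p : uniq rs ->
  jeval J x (\prod_(r <- rs) ('X - r%:P)) = 0 ->
  (forall r, r \in rs -> p.[r] = 0) -> jeval J x p = 0.
Proof.
move=> rs_uniq rs0 p_rs; have [||q ->] := @uniq_roots_prod_XsubC _ p rs.
- by apply/allP => r /p_rs pr; apply/rootP.
- by rewrite uniq_rootsE.
- by rewrite jevalM rs0 jmul0r.
Qed.

(** * Positivity and orthogonality of idempotents *)

(** The equation t = t^2 + 4(t - t^2)^2 holds at the Peirce eigenvalues 0, 1/2, 1; it shows that the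
    self-adjoint operator L(c) is positive semidefinite. *)
Lemma idem_dotE c x : c ∘ c = c ->
  f (c ∘ x) x = f (c ∘ x) (c ∘ x)
                + 4 * f (c ∘ x - c ∘ (c ∘ x)) (c ∘ x - c ∘ (c ∘ x)).
Proof.
move=> cc; have cub := jidem_cubic _ cc.
have := congr1 (fun t => f t x) (cub x).
have := congr1 (fun t => f t (c ∘ x)) (cub x).
rewrite !(dotDl, dotDr, dotNl, dotNr, dotZl).
rewrite (fA c (c ∘ (c ∘ x)) (c ∘ x)) (fA c (c ∘ (c ∘ x)) x) (fA c (c ∘ x) x).
rewrite (dotC (c ∘ x) (c ∘ (c ∘ x))); lra.
Qed.

Lemma idem_dot_ge0 c x : c ∘ c = c -> 0 <= f (c ∘ x) x.
Proof.
by move=> cc; rewrite idem_dotE // addr_ge0 ?dot_ge0 // mulr_ge0 ?dot_ge0.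
Qed.

Lemma idem_dot_eq0 c x : c ∘ c = c -> f (c ∘ x) x = 0 -> c ∘ x = 0.
Proof.
move=> cc; rewrite idem_dotE // => h; apply: dot_eq0.
have := dot_ge0 (c ∘ x); have := dot_ge0 (c ∘ x - c ∘ (c ∘ x)); lra.
Qed.

Lemma idem2_dot_ge0 c c' : c ∘ c = c -> c' ∘ c' = c' -> 0 <= f c c'.
Proof.
by move=> cc c'c'; rewrite -c'c' -fA (jmulC J c' c) idem_dot_ge0.
Qed.

Lemma idem2_dot_eq0 c c' : c ∘ c = c -> c' ∘ c' = c' -> f c c' = 0 -> c ∘ c' = 0.
Proof.
by move=> cc c'c' h; apply: idem_dot_eq0 => //; rewrite jmulC fA c'c'.
Qed.

(** Since f(c_i, c_i) = f(c_i, e), the nonnegative numbers f(c_i, c_k) with k different from i sum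
    to zero. *)
Lemma idem_sum_orthogonal (I : finType) (c : I -> V) :
  (forall i, c i ∘ c i = c i) -> \sum_i c i = e ->
  forall i j, i != j -> c i ∘ c j = 0.
Proof.
move=> cc c1 i j ij.
have : \sum_(k | k != i) f (c i) (c k) = 0.
  apply: (@addrI _ (f (c i) (c i))); rewrite -(bigD1 i (P := predT)) //= addr0.
  by rewrite -dot_sumr c1 -{1}(cc i) fA jmulr1.
move/eqP; rewrite psumr_eq0 => [/allP/(_ j (mem_index_enum j))|k _]; last first.
  exact: idem2_dot_ge0.
by rewrite eq_sym ij => /eqP; apply: idem2_dot_eq0.
Qed.

Lemma idem_family_bound k (c : 'I_k -> V) :
  (forall i, c i ∘ c i = c i) -> (forall i, c i != 0) -> \sum_i c i = e ->
  (k <= d)%N.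
Proof.
move=> cc c_neq0 c1; have co := idem_sum_orthogonal cc c1.
pose C := \matrix_(i < k, j < d) c i j 0.
suff /eqP <- : row_free C by exact: rank_leq_col.
rewrite -kermx_eq0; apply/rowV0P => u /sub_kermxP uC.
apply/rowP => j; rewrite mxE.
have u0 : \sum_i u 0 i *: c i = 0.
  apply/colP => l; have := congr1 (fun w : 'rV[R]_d => w 0 l) uC.
  rewrite summxE !mxE => uCl; rewrite -[RHS]uCl.
  by apply: eq_bigr => i _; rewrite !mxE.
have /eqP : c j ∘ (\sum_i u 0 i *: c i) = 0 by rewrite u0 jmul0r.
rewrite jmul_sumr (bigD1 j) //= big1 => [|i ij]; last first.
  by rewrite jmulZr co ?scaler0 // eq_sym.
by rewrite addr0 jmulZr cc scaler_eq0 (negPf (c_neq0 j)) orbF => /eqP.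
Qed.

(** * Spectral decomposition *)

Definition idem_decomposition x k (l : 'I_k -> R) (c : 'I_k -> V) :=
  [/\ forall i, c i ∘ c i = c i, forall i, c i != 0,
      \sum_i c i = e & \sum_i l i *: c i = x].

Lemma spectral_projections x :
  exists (rs : seq R) (D : R -> V),
    [/\ forall r, r \in rs -> D r ∘ D r = D r, \sum_(r <- rs) D r = e,
        \sum_(r <- rs) r *: D r = x,
        forall r, r \in rs -> x ∘ D r = r *: D r &
        forall r, exists p, D r = jeval J x p].
Proof.
have [rs rs_uniq rs0] := jeval_split x.
(* Values at x depend only on values on [rs], so each identity for the Lagrange polynomials is
   checked pointwise there. *)
have ext p q : (forall t, t \in rs -> p.[t] = q.[t]) -> jeval J x p = jeval J x q.
  move=> pq; apply/eqP; rewrite -subr_eq0 -jevalB; apply/eqP.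
  by apply: (jeval_vanish rs_uniq rs0) => t t_in; rewrite !hornerE pq ?subrr.
exists rs, (fun r => jeval J x (lagrange_poly rs r)); split.
- move=> r r_in; rewrite -jevalM; apply: ext => t t_in.
  by rewrite hornerM lagrange_polyE //; case: eqP => _; rewrite ?mulr1 ?mulr0.
- rewrite -jeval_sum -(jeval1 J x); apply: ext => t t_in.
  rewrite hornerE horner_sum (bigD1_seq t) //= lagrange_polyE // eqxx.
  rewrite big1_seq ?addr0 // => r /andP[rt r_in].
  by rewrite lagrange_polyE // eq_sym (negPf rt).
- under eq_bigr do rewrite -jevalZ.
  rewrite -jeval_sum -[RHS](jevalX J x); apply: ext => t t_in.
  rewrite hornerE horner_sum (bigD1_seq t) //= hornerZ lagrange_polyE // eqxx mulr1.
  rewrite big1_seq ?addr0 // => r /andP[rt r_in].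
  by rewrite hornerZ lagrange_polyE // eq_sym (negPf rt) mulr0.
- move=> r r_in; rewrite -jevalMX -jevalZ; apply: ext => t t_in.
  rewrite !hornerE lagrange_polyE //.
  by case: eqP => [->|_]; rewrite ?mulr1 ?mul1r ?mulr0 ?mul0r.
- by move=> r; exists (lagrange_poly rs r).
Qed.

Lemma idem_decomposition_exists x :
  exists k (l : 'I_k -> R) c, idem_decomposition x l c.
Proof.
have [rs [D [DD D1 Dx _ _]]] := spectral_projections x.
(* A root of the annihilator need not be an eigenvalue of x; roots with zero projection are
   dropped. *)
pose s := [seq r <- rs | D r != 0].
exists (size s), (fun i => s`_i), (fun i => D s`_i).
have mem_s (i : 'I_(size s)) : (s`_i \in rs) && (D s`_i != 0).
  by have := mem_nth 0 (ltn_ord i); rewrite mem_filter andbC.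
have sumE (F : R -> V) : (forall r, D r = 0 -> F r = 0) ->
    \sum_(i < size s) F s`_i = \sum_(r <- rs) F r.
  move=> F0; rewrite -(big_mkord predT (fun i => F s`_i)) -(big_nth 0 predT F).
  rewrite big_filter big_mkcond; apply: eq_bigr => r _.
  by case: eqP => //= /F0.
split=> [i|i||].
- by have /andP[/DD] := mem_s i.
- by have /andP[] := mem_s i.
- by rewrite sumE.
- by rewrite (sumE (fun r => r *: D r)) // => r ->; rewrite scaler0.
Qed.

(* Splitting a non-primitive idempotent enlarges the family, whose size is
   bounded by the dimension. *)
Lemma spectral_decomposition_exists x :
  exists k (l : 'I_k -> R) c, spectral_decomposition J x l c.
Proof.
have [k [l [c cP]]] := idem_decomposition_exists x.
(* The successor makes the base case vacuous; [idem_family_bound] for the enlarged family ensures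
   that the truncated difference decreases. *)
move: {2}(d - k).+1 (leqnn (d - k).+1) => n.
elim: n k l c cP => [//|n IHn] k l c [cc c_neq0 c1 cx] le_n.
have [cprim|] := pselect (forall i, primitive_idempotent J (c i)).
  exists k, l, c; split => //; split => //.
  exact: idem_sum_orthogonal.
move=> /existsNP[i0 /not_and3P nprim].
have {nprim} : exists u v, [/\ u ∘ u = u, v ∘ v = v, u != 0, v != 0 &
                           c i0 = u + v].
  case: nprim => [|/negP|/contrapT//]; first by move/(_ (cc i0)).
  by rewrite c_neq0.
case=> u [v [uu vv u_neq0 v_neq0 cuv]].
pose l' (i : 'I_k.+1) := if unlift ord0 i is Some j then l j else l i0.
pose c' (i : 'I_k.+1) :=
  if unlift ord0 i is Some j then (if j == i0 then u else c j) else v.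
have sumE (a : 'I_k -> R) :
    a i0 *: v + \sum_i a i *: (if i == i0 then u else c i) = \sum_i a i *: c i.
  rewrite (bigD1 i0) //= [RHS](bigD1 i0) //= eqxx addrA -scalerDr (addrC v) -cuv.
  by congr (_ + _); apply: eq_bigr => i /negPf->.
have cP' : idem_decomposition x l' c'.
  split=> [i|i||]; rewrite /c' /l'.
  - by case: unliftP => [j _|//]; case: ifP.
  - by case: unliftP => [j _|//]; case: ifP.
  - rewrite big_ord_recl unlift_none -c1; have := sumE (fun=> 1); rewrite scale1r.
    under eq_bigr do rewrite scale1r; under [RHS]eq_bigr do rewrite scale1r.
    by move=> <-; congr (_ + _); apply: eq_bigr => i _; rewrite liftK.
  - rewrite big_ord_recl !unlift_none -cx -sumE; congr (_ + _).
    by apply: eq_bigr => i _; rewrite !liftK.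
case: (cP') => c'c' c'_neq0 c'1 _; have := idem_family_bound c'c' c'_neq0 c'1.
by move=> le_kd; apply: (IHn _ _ _ cP'); move: le_n le_kd; lia.
Qed.

(** * Calculus in a Jordan frame *)

Section Frame.
Variables (k : nat) (c : 'I_k -> V).
Hypothesis c_frame : jordan_frame J c.

Lemma frame_idem i : c i ∘ c i = c i.
Proof. by case: c_frame => /(_ i)[]. Qed.

Lemma frame_dot i j : i != j -> f (c i) (c j) = 0.
Proof.
case: c_frame => _ c_orth _ ij.
by rewrite -(jmulr1 J (c i)) fA c_orth // dotC dot0l.
Qed.

Lemma frame_mul (l l' : 'I_k -> R) :
  (\sum_i l i *: c i) ∘ (\sum_i l' i *: c i) = \sum_i (l i * l' i) *: c i.
Proof.
case: c_frame => _ c_orth _; rewrite jmul_suml; apply: eq_bigr => i _.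
rewrite jmul_sumr (bigD1 i) //= big1 => [|j ij].
  by rewrite addr0 jmulZl jmulZr scalerA frame_idem.
by rewrite jmulZl jmulZr c_orth ?scaler0 // eq_sym.
Qed.

Lemma frame_jP (l l' : 'I_k -> R) :
  P (\sum_i l i *: c i) (\sum_i l' i *: c i) = \sum_i (l i ^+ 2 * l' i) *: c i.
Proof.
rewrite /jP /jL !frame_mul scaler_sumr -sumrB; apply: eq_bigr => i _.
by rewrite scalerA -scalerBl; congr (_ *: _); ring.
Qed.

Lemma frame_one : \sum_i 1 *: c i = e.
Proof. by case: c_frame => _ _ <-; apply: eq_bigr => i _; rewrite scale1r. Qed.

Lemma frame_jeval (l : 'I_k -> R) p :
  jeval J (\sum_i l i *: c i) p = \sum_i p.[l i] *: c i.
Proof.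
elim/poly_ind: p => [|p a IHp].
  by rewrite jeval0 big1 // => i _; rewrite horner0 scale0r.
rewrite jevalD jevalMX jevalC IHp frame_mul -frame_one scaler_sumr -big_split.
apply: eq_bigr => i _ /=; rewrite hornerMXaddC scalerA mulr1.
by rewrite -scalerDl mulrC.
Qed.

End Frame.

(** Independence of the decomposition: a polynomial p interpolating g at the eigenvalues of both
    decompositions makes both sums equal to p(x). *)
Lemma spectral_mapE g x k (l : 'I_k -> R) c : spectral_decomposition J x l c ->
  spectral_map J g x = \sum_i g (l i) *: c i.
Proof.
move=> xP; rewrite /spectral_map; case: xgetP => [y _|]; last first.
  by move/(_ (\sum_i g (l i) *: c i)); case; exists k, l, c.
case: xP => c_frame xE [k' [l' [c' [[c'_frame xE'] ->]]]].
have [|p pE] := @interpolation _ (undup (codom l ++ codom l')) g.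
  exact: undup_uniq.
have lE i : g (l i) = p.[l i] by rewrite pE // mem_undup mem_cat codom_f.
have l'E i : g (l' i) = p.[l' i].
  by rewrite pE // mem_undup mem_cat (codom_f l') orbT.
transitivity (jeval J x p).
  by rewrite xE' frame_jeval //; apply: eq_bigr => i _; rewrite l'E.
by rewrite xE frame_jeval //; apply: eq_bigr => i _; rewrite lE.
Qed.

Lemma jP_dot x y z : f (P x y) z = f y (P x z).
Proof.
rewrite /jP /jL !(dotDl, dotDr, dotNl, dotNr, dotZl, dotZr) (fA (x ∘ x)).
by rewrite (fA x (x ∘ y)) (fA x y).
Qed.

(** * Primitive idempotents and the trace *)

(** The spectral projections of z = P(c) v at nonzero eigenvalues lie in the Peirce 1-space of c.
    One other than 0 and c would split c. *)
Lemma primitive_jP c v : primitive_idempotent J c -> exists t, P c v = t *: c.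
Proof.
case=> cc c_neq0 c_prim; set z := P c v.
have cz : c ∘ z = z by exact: jP_jidemK.
(* The factor z keeps the element in the Peirce space, which p(z) can leave through its constant
   term. *)
have czp p : c ∘ (z ∘ jeval J z p) = z ∘ jeval J z p.
  elim/poly_ind: p => [|p a IHp]; first by rewrite jeval0 !jmul0r.
  rewrite jevalD jevalMX jevalC !jmulDr !jmulZr !jmulr1 cz.
  by rewrite jidem_subalgebra.
have [rs [D [DD _ zE zD Dp]]] := spectral_projections z.
have Dc r : r \in rs -> exists t, r *: D r = t *: c.
  move=> r_in; have [->|r_neq0] := eqVneq r 0; first by exists 0; rewrite !scale0r.
  have [->|D_neq0] := eqVneq (D r) 0; first by exists 0; rewrite scaler0 scale0r.
  have cD : c ∘ D r = D r.
    apply: (scalerI r_neq0); rewrite -jmulZr -zD //.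
    by have [p ->] := Dp r; rewrite czp.
  exists r; congr (_ *: _); apply: contra_notP c_prim => /eqP D_neq.
  exists (D r), (c - D r); split=> //; first exact: DD.
  - rewrite /Defs.idempotent !jmulE cc cD (jmulC J (D r)) cD DD //.
    by rewrite opprK addNr addr0.
  - by rewrite subr_eq0 eq_sym.
  - by rewrite addrC subrK.
rewrite -zE; elim: (rs) Dc => [|r s IHs] Dc.
  by exists 0; rewrite big_nil scale0r.
have [t tE] := Dc r (mem_head _ _).
have [|t' t'E] := IHs; first by move=> q q_in; apply: Dc; rewrite inE q_in orbT.
by exists (t + t'); rewrite big_cons tE t'E scalerDl.
Qed.

Lemma primitive_dot_gt0 c : primitive_idempotent J c -> 0 < f c c.
Proof. by case=> _ c_neq0 _; exact: dot_gt0. Qed.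

Lemma idem_jP_dot c c' : c ∘ c = c -> c' ∘ c' = c' ->
  f (P c c') c' = 2 * f (c ∘ c') (c ∘ c') - f c c'.
Proof.
move=> cc c'c'; have fcc' : f (c ∘ c') c' = f c c' by rewrite jmulC fA c'c'.
by rewrite /jP /jL cc dotDl dotNl dotZl fA fcc'.
Qed.

(* The right-hand side of idem_jP_dot is symmetric in c and c'. *)
Lemma primitive_dot_eq c c' : primitive_idempotent J c ->
  primitive_idempotent J c' -> f c c' != 0 -> f c c = f c' c'.
Proof.
move=> c_prim c'_prim fcc'.
have [t tE] := primitive_jP c' c_prim; have [t' t'E] := primitive_jP c c'_prim.
have [[cc _ _] [c'c' _ _]] := (c_prim, c'_prim).
have Pid x : x ∘ x = x -> P x x = x by move=> xx; apply: jP_jidem_id.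
have e1 : t * f c c = f c c' by rewrite -dotZl -tE jP_dot Pid // dotC.
have e2 : t' * f c' c' = f c c' by rewrite -dotZl -t'E jP_dot Pid.
have e3 : t * f c c' = t' * f c c'.
  rewrite -dotZl -tE (dotC c c') -dotZl -t'E !idem_jP_dot // (jmulC J c' c).
  by rewrite (dotC c').
have tt' : t = t' by exact: (mulIf fcc').
have t_neq0 : t != 0 by apply: contra fcc' => /eqP t0; rewrite -e1 t0 mul0r.
by apply: (mulfI t_neq0); rewrite e1 tt' e2.
Qed.

(** In each nonzero term the denominator equals f(c', c') by [primitive_dot_eq], so the sum is f(e,
    c') / f(c', c'). *)
Lemma frame_dot_primitive k (c : 'I_k -> V) c' :
  jordan_frame J c -> primitive_idempotent J c' ->
  \sum_i f (c i) c' / f (c i) (c i) = 1.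
Proof.
case=> c_prim _ c1 c'_prim; have c'_gt0 := primitive_dot_gt0 c'_prim.
transitivity (\sum_i f (c i) c' / f c' c').
  apply: eq_bigr => i _; have [->|neq0] := eqVneq (f (c i) c') 0.
    by rewrite !mul0r.
  by rewrite (primitive_dot_eq (c_prim i) c'_prim neq0).
rewrite -mulr_suml -dot_suml c1; case: c'_prim => c'c' _ _.
by rewrite -{1}c'c' dotC dot_sqr divff // gt_eqF.
Qed.

(* By frame_dot_primitive, the linear functional on the right takes the value 1
   at every primitive idempotent, hence computes the trace of any spectral
   decomposition. *)
Lemma jtraceE k (c : 'I_k -> V) x : jordan_frame J c ->
  jtrace J x = \sum_i f (c i) x / f (c i) (c i).
Proof.
move=> c_frame; have [n [l [c' xP]]] := spectral_decomposition_exists x.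
rewrite /jtrace; case: xgetP => [y _|]; last first.
  by move/(_ (\sum_i l i)); case; exists n, l, c'.
case=> {l c' xP} n' [l [c' [[c'_frame ->] ->]]].
under [RHS]eq_bigr do rewrite dot_sumr mulr_suml.
rewrite exchange_big; apply: eq_bigr => j _ /=.
under eq_bigr do rewrite dotZr -mulrA.
rewrite -mulr_sumr frame_dot_primitive ?mulr1 //.
by case: c'_frame.
Qed.

(** * Positive elements *)

(* Membership in int K, tested against primitive idempotents only. *)
Definition jpositive x := forall c, primitive_idempotent J c -> 0 < f x c.

Lemma jpositive_eig x k (l : 'I_k -> R) c : spectral_decomposition J x l c ->
  jpositive x -> forall i, 0 < l i.
Proof.
move=> [c_frame ->] x_pos i; have ci_prim : primitive_idempotent J (c i) by case: c_frame.
have := x_pos _ ci_prim; rewrite dot_suml (bigD1 i) //= big1 => [|j ji].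
  by rewrite addr0 dotZl pmulr_lgt0 // primitive_dot_gt0.
by rewrite dotZl (frame_dot c_frame ji) mulr0.
Qed.

(** The nonnegative numbers f(c_i, v) sum to f(e, v) > 0, so one of them is positive. *)
Lemma eig_dot_gt0 x k (l : 'I_k -> R) c v : spectral_decomposition J x l c ->
  (forall i, 0 < l i) -> v ∘ v = v -> v != 0 -> 0 < f x v.
Proof.
move=> [c_frame ->] l_gt0 vv v_neq0.
have cv_ge0 i : 0 <= f (c i) v by rewrite idem2_dot_ge0 // frame_idem.
rewrite dot_suml lt_neqAle sumr_ge0 => [|i _]; last first.
  by rewrite dotZl mulr_ge0 // ltW.
rewrite andbT eq_sym psumr_neq0 => [|i _]; last by rewrite dotZl mulr_ge0 // ltW.
apply/hasP; have : 0 < f e v by rewrite dotC -{1}vv dot_sqr dot_gt0.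
case: (c_frame) => _ _ <-; rewrite dot_suml lt_neqAle eq_sym => /andP[+ _].
rewrite psumr_neq0 // => /hasP[i i_in /= cv_gt0]; exists i => //=.
by rewrite dotZl mulr_gt0.
Qed.

Lemma eig_jpositive x k (l : 'I_k -> R) c : spectral_decomposition J x l c ->
  (forall i, 0 < l i) -> jpositive x.
Proof.
by move=> xP l_gt0 c' [c'c' c'_neq0 _]; apply: (eig_dot_gt0 xP).
Qed.

Lemma jpositive_idem x v : jpositive x -> v ∘ v = v -> v != 0 -> 0 < f x v.
Proof.
move=> x_pos; have [k [l [c xP]]] := spectral_decomposition_exists x.
exact: (eig_dot_gt0 xP (jpositive_eig xP x_pos)).
Qed.

Lemma spectral_map_jpositive g x : (forall t, 0 < t -> 0 < g t) ->
  jpositive x -> jpositive (spectral_map J g x).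
Proof.
move=> g_gt0 x_pos; have [k [l [c xP]]] := spectral_decomposition_exists x.
have l_gt0 := jpositive_eig xP x_pos.
apply: (@eig_jpositive _ _ (fun i => g (l i)) c) => [|i]; last exact: g_gt0.
by split; [case: xP | exact: spectral_mapE].
Qed.

Lemma jsqrt_jpositive x : jpositive x -> jpositive (jsqrt J x).
Proof. by apply: spectral_map_jpositive => t; rewrite sqrtr_gt0. Qed.

Lemma jinv_jpositive x : jpositive x -> jpositive (jinv J x).
Proof. by apply: spectral_map_jpositive => t; rewrite invr_gt0. Qed.

Lemma jinvsqrt_jpositive x : jpositive x -> jpositive (jinvsqrt J x).
Proof. by apply: spectral_map_jpositive => t; rewrite invr_gt0 sqrtr_gt0. Qed.

Lemma jsqrt_sqr x : jpositive x -> jsqrt J x ∘ jsqrt J x = x.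
Proof.
move=> x_pos; have [k [l [c xP]]] := spectral_decomposition_exists x.
have l_gt0 := jpositive_eig xP x_pos.
rewrite /jsqrt (spectral_mapE _ xP); case: xP => c_frame ->.
rewrite frame_mul //; apply: eq_bigr => i _.
by rewrite -expr2 sqr_sqrtr // ltW.
Qed.

Lemma jP_jinv x : jpositive x -> P x (jinv J x) = x.
Proof.
move=> x_pos; have [k [l [c xP]]] := spectral_decomposition_exists x.
have l_gt0 := jpositive_eig xP x_pos.
rewrite /jinv (spectral_mapE _ xP); case: xP => c_frame ->.
rewrite frame_jP //; apply: eq_bigr => i _.
by rewrite expr2 mulfK // gt_eqF.
Qed.

Lemma jP_jsqrt_jinvsqrt x : jpositive x ->
  P (jsqrt J x) (jinvsqrt J x) = jsqrt J x.
Proof.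
move=> x_pos; have [k [l [c xP]]] := spectral_decomposition_exists x.
have l_gt0 := jpositive_eig xP x_pos.
rewrite /jsqrt /jinvsqrt !(spectral_mapE _ xP); case: xP => c_frame _.
rewrite frame_jP //; apply: eq_bigr => i _.
by rewrite expr2 mulfK // gt_eqF // sqrtr_gt0.
Qed.

Lemma jP_inj x : jpositive x -> injective (P x).
Proof.
move=> x_pos; have [k [l [c xP]]] := spectral_decomposition_exists x.
have l_gt0 := jpositive_eig xP x_pos.
have [v xv] : exists v, P x v = e.
  (* The witness is x^(-2); then P(x) P(v) P(x) = P(P(x) v) = P(e) is the identity map. *)
  case: xP => c_frame ->; exists (\sum_i (l i) ^- 2 *: c i).
  rewrite frame_jP // -(frame_one c_frame); apply: eq_bigr => i _.
  by rewrite mulfV // expf_neq0 // gt_eqF.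
apply: (can_inj (g := fun y => P x (P v y))) => y.
by rewrite -jP_fundamental xv jP_one.
Qed.

(** With s, t the two roots, P(s) P(t) P(s) = P(P(s) t) = P(s); cancel the injective P(s). *)
Lemma jP_jinvsqrtK x : jpositive x ->
  cancel (P (jsqrt J x)) (P (jinvsqrt J x)).
Proof.
move=> x_pos y; apply: (jP_inj (jsqrt_jpositive x_pos)).
by rewrite -jP_fundamental jP_jsqrt_jinvsqrt.
Qed.

(* P(x) sends a primitive idempotent c to an element v with v^2 = t v, where
   P(c)x^2 = t c, that is, to a positive multiple of an idempotent. *)
Lemma jP_jpositive x y : injective (P x) -> jpositive y -> jpositive (P x y).
Proof.
move=> x_inj y_pos c c_prim; have [cc c_neq0 _] := c_prim.
rewrite jP_dot; set v := P x c.
have v_neq0 : v != 0 by apply: contra c_neq0 => /eqP v0; apply/eqP/x_inj; rewrite jP0.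
have [t tE] := primitive_jP (x ∘ x) c_prim.
have vv : v ∘ v = t *: v by rewrite jP_sqr tE jPZ.
have t_gt0 : 0 < t.
  have := dot_gt0 v_neq0; rewrite -dot_sqr vv dotZl => tv_gt0.
  have t_ge0 : 0 <= t.
    rewrite -(pmulr_lge0 _ (primitive_dot_gt0 c_prim)) -dotZl -tE jP_dot.
    by rewrite (jP_jidem_id cc cc) fA (jmulC J x c) dotC idem_dot_ge0.
  rewrite lt_neqAle t_ge0 andbT eq_sym; apply: contraTneq tv_gt0 => ->.
  by rewrite mul0r ltxx.
have t_neq0 : t != 0 by rewrite gt_eqF.
rewrite -[v]scale1r -(mulfV t_neq0) -scalerA dotZr mulr_gt0 // jpositive_idem //.
- by rewrite jmulZl jmulZr vv !scalerA mulfVK.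
- by rewrite scaler_eq0 invr_eq0 (negPf t_neq0).
Qed.

(** * The Riccati equation and the update rule *)

(** The mean is P(s) q, so its quadratic representation is P(s) P(q) P(s), a product of injective
    maps. As P(s) e = a, it remains to see that P(q) P(s) u = e. *)
Lemma gmean_riccati a u : jpositive a -> jpositive u ->
  P (gmean J a (jinv J u)) u = a /\ injective (P (gmean J a (jinv J u))).
Proof.
move=> a_pos u_pos; rewrite /gmean.
set s := jsqrt J a; set t := jinvsqrt J a; set v := jinv J u.
set z := P t v; set q := jsqrt J z.
have s_inj : injective (P s) by exact/jP_inj/jsqrt_jpositive.
have z_pos : jpositive z.
  by apply: jP_jpositive; [exact/jP_inj/jinvsqrt_jpositive | exact: jinv_jpositive].
have q_inj : injective (P q) by exact/jP_inj/jsqrt_jpositive.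
have vu : P v u = v.
  have uv : P u v = u by exact: jP_jinv.
  by apply: (jP_inj u_pos); have := jP_fundamental J u v v; rewrite !uv => <-.
split; last first.
  by move=> y y'; rewrite !jP_fundamental => /s_inj/q_inj/s_inj.
rewrite jP_fundamental (_ : P q (P s u) = e); first by rewrite jP1 jsqrt_sqr.
(* P(q) P(q) = P(q^2) = P(z) = P(t) P(v) P(t), which sends P(s) u to P(t) P(v) u = P(t) v = z = P(q)
   e. *)
apply: q_inj; rewrite jP1 -[P q (P s u)](jP_one J) -jP_fundamental jP1 jsqrt_sqr //.
by rewrite jP_fundamental jP_jinvsqrtK // vu.
Qed.

(** For small k > 0, x - k e is still a square z^2; pairing with c gives f(z^2, c) >= 0 and f(e, c)
    > 0. *)
Lemma interior_jpositive x : (cone_of_squares J)^° x -> jpositive x.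
Proof.
move=> x_int c c_prim; have [cc c_neq0 _] := c_prim.
have lim : (fun k : R => x - k *: e) k @[k --> 0%R] --> x.
  rewrite -[X in _ --> X]subr0 -(scale0r e); apply: cvgB; first exact: cvg_cst.
  by apply: cvgZr_tmp; exact: cvg_id.
have [k k_gt0 [z _ zE]] : exists2 k : R, 0 < k & cone_of_squares J (x - k *: e).
  have /nbhs_ballP[r /= r_gt0 rP] := lim _ x_int.
  exists (r / 2); first by rewrite divr_gt0.
  by apply: rP; rewrite /ball /= sub0r normrN gtr0_norm ?divr_gt0 //; lra.
have -> : x = z ∘ z + k *: e by rewrite zE subrK.
rewrite dotDl dotZl ltr_wpDl ?mulr_gt0 //.
  by rewrite fA (jmulC J z c) dotC idem_dot_ge0.
by rewrite dotC -{1}cc dot_sqr dot_gt0.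
Qed.

(** [jtraceE] in a frame diagonalizing y gives a sum of positive terms, nonempty because e is
    nonzero. *)
Lemma jinner_gt0 x y : e != 0 -> jpositive x -> jpositive y -> 0 < jinner J x y.
Proof.
move=> e_neq0 x_pos y_pos; have [k [l [c yP]]] := spectral_decomposition_exists y.
have l_gt0 := jpositive_eig yP y_pos; case: (yP) => c_frame yE.
have [c_prim _ c1] := c_frame.
have term i : f (c i) (x ∘ y) / f (c i) (c i) = l i * (f x (c i) / f (c i) (c i)).
  have yc : y ∘ c i = l i *: c i.
    rewrite yE jmul_suml (bigD1 i) //= big1 => [|j ji].
      by rewrite addr0 jmulZl frame_idem.
    by rewrite jmulZl; case: c_frame => _ -> //; rewrite scaler0.
  by rewrite jmulC dotC fA yc dotZr mulrA.
rewrite /jinner (jtraceE _ c_frame); under eq_bigr do rewrite term.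
have term_gt0 i : 0 < l i * (f x (c i) / f (c i) (c i)).
  by rewrite mulr_gt0 ?divr_gt0 ?primitive_dot_gt0 ?x_pos.
case: k l c {yP yE term} l_gt0 c_frame c_prim c1 term_gt0 => [|k] l c _ _ _ c1 l_gt0.
  by move: e_neq0; rewrite -c1 big_ord0 eqxx.
by rewrite big_ord_recl ltr_wpDr // sumr_ge0 // => i _; rewrite ltW.
Qed.

Lemma update_fixed_point (n : nat) (b : 'I_n -> V) (a : V) (X : 'cV[R]_n) :
  jpositive a -> (forall j, jpositive (b j)) ->
  a = P (gmean J a (jinv J (inner_map_adj b (inner_map J b a)))) (inner_map_adj b X) ->
  inner_map_adj b X = inner_map_adj b (inner_map J b a).
Proof.
(* For an empty family both sides are zero; otherwise u is a nonempty positive combination of the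
   b_j. *)
case: n b X => [|n] b X a_pos b_pos; first by rewrite /inner_map_adj !big_ord0.
set u := inner_map_adj b (inner_map J b a) => aE.
have u_pos : jpositive u.
  move=> c c_prim.
  have e_neq0 : e != 0.
    case: c_prim => _ + _; apply: contra => /eqP e0.
    by rewrite -[c](jmul1 J) e0 jmul0l.
  have term_gt0 i : 0 < f (inner_map J b a i 0 *: b i) c.
    by rewrite dotZl mxE mulr_gt0 ?jinner_gt0 ?b_pos.
  rewrite /u /inner_map_adj dot_suml big_ord_recl ltr_wpDr //.
  by rewrite sumr_ge0 // => i _; rewrite ltW.
have [wu w_inj] := gmean_riccati a_pos u_pos.
by apply: w_inj; rewrite -aE wu.
Qed.

End SpectralTheorem.

Theorem theorem4p4 (R : realType) (d : nat) (J : jordanAlgebra R d)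
  (J_euclidean : euclidean J)
  (m n : nat) (X : 'M[R]_(m, n)) (X_ge0 : forall i j, 0 <= X i j)
  (a : 'I_m -> 'cV[R]_d) (b : 'I_n -> 'cV[R]_d)
  (a_int : forall i, interior (cone_of_squares J) (a i))
  (b_int : forall j, interior (cone_of_squares J) (b j))
  (a_fixed : forall i,
    a i = jP J (gmean J (a i)
                  (jinv J (inner_map_adj b (inner_map J b (a i)))))
               (inner_map_adj b (row i X)^T))
  (b_fixed : forall j,
    b j = jP J (gmean J (b j)
                  (jinv J (inner_map_adj a (inner_map J a (b j)))))
               (inner_map_adj a (col j X))) :
  (forall i, inner_map_adj b (row i X)^T
             = inner_map_adj b (inner_map J b (a i))) /\
  (forall j, inner_map_adj a (col j X)
             = inner_map_adj a (inner_map J a (b j))).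
Proof.
case: J_euclidean => f fA.
have a_pos i : jpositive J f (a i) by exact: interior_jpositive.
have b_pos j : jpositive J f (b j) by exact: interior_jpositive.
by split=> [i|j]; [apply: (update_fixed_point fA (a_pos i) b_pos)
                  | apply: (update_fixed_point fA (b_pos j) a_pos)].
Qed.
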